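(* Let $\mathcal{L}_{\text{comp}}, \mathcal{L}_{\text{add}}, \mathcal{L}_{\text{ind}}, \mathcal{L}_{\text{confirm}}, \mathcal{L}_{\text{cond}}, \mathcal{L}_{\text{quad}}, \mathcal{L}_{\text{poly}}$ be the probabilistic languages defined in the context. Then: (i) $\mathcal{L}_{\text{comp}}$ is strictly less expressive than $\mathcal{L}_{\text{add}}$, which is strictly less expressive than $\mathcal{L}_{\text{poly}}$; (ii) in each of the series $\mathcal{L}_{\text{comp}}, \mathcal{L}_{\text{cond}}, \mathcal{L}_{\text{quad}}, \mathcal{L}_{\text{poly}}$ and $\mathcal{L}_{\text{ind}}, \mathcal{L}_{\text{confirm}}, \mathcal{L}_{\text{cond}}$, each language is strictly less expressive than the one that follows it; (iii) any two of these seven languages that are not related by the transitive closure of the relations in (i) and (ii) are incomparable in expressivity; that is, each of $\mathcal{L}_{\text{ind}}$ and $\mathcal{L}_{\text{confirm}}$ is incomparable with each of $\mathcal{L}_{\text{comp}}$ and $\mathcal{L}_{\text{add}}$, and $\mathcal{L}_{\text{add}}$ is incomparable with each of $\mathcal{L}_{\text{cond}}$ and $\mathcal{L}_{\text{quad}}$.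
   Context: Let $\mathsf{Prop}$ be a countably infinite set of proposition letters and $\sigma(\mathsf{Prop})$ the set of all Boolean combinations over $\mathsf{Prop}$. Sets of terms, for $\alpha,\beta$ ranging over $\sigma(\mathsf{Prop})$: $T_{\text{uncond}}$ consists of the terms $\mathbf{P}(\alpha)$; $T_{\text{cond}}$ of the terms $\mathbf{P}(\alpha|\beta)$; $T_{\text{add}}$ is generated from the $\mathbf{P}(\alpha)$ by the binary operation $+$; $T_{\text{quad}}$ consists of the terms $\mathbf{P}(\alpha)\cdot\mathbf{P}(\beta)$; $T_{\text{poly}}$ is generated from the $\mathbf{P}(\alpha)$ by the binary operations $+$ and $\cdot$. For a set of terms $T$, $\Lambda(T)$ is the set of all Boolean combinations (built with $\neg,\wedge$) of atomic formulas $\mathsf{a}\succsim\mathsf{b}$ with $\mathsf{a},\mathsf{b}\in T$. Put $\mathcal{L}_{\text{comp}}=\Lambda(T_{\text{uncond}})$, $\mathcal{L}_{\text{add}}=\Lambda(T_{\text{add}})$, $\mathcal{L}_{\text{cond}}=\Lambda(T_{\text{cond}})$, $\mathcal{L}_{\text{quad}}=\Lambda(T_{\text{quad}})$, $\mathcal{L}_{\text{poly}}=\Lambda(T_{\text{poly}})$. $\mathcal{L}_{\text{ind}}$ is the set of Boolean combinations of atoms $\mathsf{a}=\mathsf{b}$ and $\mathsf{a}\perp\!\!\!\perp\mathsf{b}$ with $\mathsf{a},\mathsf{b}\in T_{\text{uncond}}$. $\mathcal{L}_{\text{confirm}}$ is the set of Boolean combinations of atoms $\mathbf{P}(\alpha|\beta)\succsim\mathbf{P}(\alpha)$,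 $\mathbf{P}(\alpha)\succsim\mathbf{P}(\alpha|\beta)$, and $\mathbf{P}(\alpha)=\mathbf{P}(\beta)$ with $\alpha,\beta\in\sigma(\mathsf{Prop})$. A model is $\mathfrak{M}=(\Omega,\mathcal{F},\mathbb{P},[\![\cdot]\!])$ with $(\Omega,\mathcal{F},\mathbb{P})$ a probability space and $[\![\cdot]\!]:\sigma(\mathsf{Prop})\to\wp(\Omega)$ a Boolean valuation (connectives interpreted as set operations) with $[\![A]\!]\in\mathcal{F}$ for $A\in\mathsf{Prop}$. Terms: $\mathbf{P}(\alpha)^{\mathfrak{M}}=\mathbb{P}([\![\alpha]\!])$, with $+$ and $\cdot$ interpreted as real addition and multiplication. $\mathfrak{M}\models\mathsf{a}\succsim\mathsf{b}$ iff $\mathsf{a}^{\mathfrak{M}}\geq\mathsf{b}^{\mathfrak{M}}$; $\mathfrak{M}\models\mathsf{a}=\mathsf{b}$ iff $\mathsf{a}^{\mathfrak{M}}=\mathsf{b}^{\mathfrak{M}}$; $\mathfrak{M}\models\mathbf{P}(\alpha|\beta)\succsim\mathbf{P}(\gamma|\delta)$ iff $\mathbb{P}([\![\alpha\wedge\beta]\!])\mathbb{P}([\![\delta]\!])\geq\mathbb{P}([\![\gamma\wedge\delta]\!])\mathbb{P}([\![\beta]\!])$; $\mathfrak{M}\models\mathbf{P}(\alpha)\perp\!\!\!\perp\mathbf{P}(\beta)$ iff $\mathbb{P}([\![\alpha\wedge\beta]\!])=\mathbb{P}([\![\alpha]\!])\mathbb{P}([\![\beta]\!])$; $\mathfrak{M}\models\mathbf{P}(\alpha|\beta)\succsim\mathbf{P}(\alpha)$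 iff $\mathbb{P}([\![\alpha\wedge\beta]\!])\geq\mathbb{P}([\![\alpha]\!])\mathbb{P}([\![\beta]\!])$; $\mathfrak{M}\models\mathbf{P}(\alpha)\succsim\mathbf{P}(\alpha|\beta)$ iff $\mathbb{P}([\![\alpha\wedge\beta]\!])\leq\mathbb{P}([\![\alpha]\!])\mathbb{P}([\![\beta]\!])$. Boolean combinations are evaluated as usual. Let $\mathrm{Mod}(\varphi)=\{\mathfrak{M}:\mathfrak{M}\models\varphi\}$. $\mathcal{L}_2$ is at least as expressive as $\mathcal{L}_1$ if for every $\varphi\in\mathcal{L}_1$ there is $\psi\in\mathcal{L}_2$ with $\mathrm{Mod}(\varphi)=\mathrm{Mod}(\psi)$. $\mathcal{L}_1$ is strictly less expressive than $\mathcal{L}_2$ if $\mathcal{L}_2$ is at least as expressive as $\mathcal{L}_1$ but not vice versa. Two languages are incomparable in expressivity if neither is at least as expressive as the other. *)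

(* Defs.v *)
From HB Require Import structures.
From mathcomp Require Import all_boot all_order all_algebra.
From mathcomp Require Import all_classical all_reals all_analysis.

Set Implicit Arguments.
Unset Strict Implicit.
Unset Printing Implicit Defensive.

Import Order.TTheory GRing.Theory Num.Theory.

Local Open Scope classical_set_scope.
Local Open Scope ring_scope.

(* Used at two levels: for the Boolean combinations of proposition letters
   (events) and for the Boolean combinations of atomic formulas. *)
Inductive bcomb (A : Type) : Type :=
| Atom of A
| Neg of bcomb A
| And of bcomb A & bcomb A.

Fixpoint bholds (A : Type) (h : A -> Prop) (phi : bcomb A) : Prop :=
  match phi with
  | Atom a => h a
  | Neg phi => ~ bholds h phi
  | And phi psi => bholds h phi /\ bholds h psi
  end.

Section Syntax.
Variable L : Type.

Notation event := (bcomb L).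

Variant uncond_term : Type := UncondPr of event.

(* [CondPr a b] stands for P(a | b). *)
Variant cond_term : Type := CondPr of event & event.

Inductive add_term : Type :=
| AddPr of event
| AddPlus of add_term & add_term.

Variant quad_term : Type := QuadMul of event & event.

Inductive poly_term : Type :=
| PolyPr of event
| PolyPlus of poly_term & poly_term
| PolyMul of poly_term & poly_term.

Variant geq_atom (T : Type) : Type := Geq of T & T.

Variant ind_atom : Type :=
| IndEq of uncond_term & uncond_term
| IndIndep of uncond_term & uncond_term.

Variant confirm_atom : Type :=
| CondGeq of event & event    (* P(a | b) >= P(a) *)
| GeqCond of event & event    (* P(a) >= P(a | b) *)
| ConfirmEq of event & event. (* P(a) = P(b) *)

End Syntax.

Record model (R : realType) (L : Type) := Model {
  disp : measure_display;
  outcome : measurableType disp;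
  prob : probability outcome R;
  valuation : bcomb L -> set outcome;
  valuation_Neg : forall a, valuation (Neg a) = ~` valuation a;
  valuation_And : forall a b,
    valuation (And a b) = valuation a `&` valuation b;
  valuation_measurable : forall x : L, measurable (valuation (Atom x))
}.

Arguments valuation {R L} m _.

Section Semantics.
Variables (R : realType) (L : Type).
Implicit Types (M : model R L) (a b : bcomb L).

Definition Pr M a : R := fine (prob M (valuation M a)).

Definition uncond_value M (t : uncond_term L) : R :=
  let: UncondPr a := t in Pr M a.

Fixpoint add_value M (t : add_term L) : R :=
  match t with
  | AddPr a => Pr M a
  | AddPlus s t => add_value M s + add_value M t
  end.

Definition quad_value M (t : quad_term L) : R :=
  let: QuadMul a b := t in Pr M a * Pr M b.

Fixpoint poly_value M (t : poly_term L) : R :=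
  match t with
  | PolyPr a => Pr M a
  | PolyPlus s t => poly_value M s + poly_value M t
  | PolyMul s t => poly_value M s * poly_value M t
  end.

Definition geq_holds (T : Type) (value : model R L -> T -> R) M
    (x : geq_atom T) : Prop :=
  let: Geq s t := x in value M s >= value M t.

(* Conditional terms have no value of their own: comparisons are
   cross-multiplied, so conditioning on a null event is allowed. *)
Definition cond_holds M (x : geq_atom (cond_term L)) : Prop :=
  let: Geq (CondPr a b) (CondPr c d) := x in
  Pr M (And a b) * Pr M d >= Pr M (And c d) * Pr M b.

Definition ind_holds M (x : ind_atom L) : Prop :=
  match x with
  | IndEq s t => uncond_value M s = uncond_value M t
  | IndIndep (UncondPr a) (UncondPr b) => Pr M (And a b) = Pr M a * Pr M b
  end.

Definition confirm_holds M (x : confirm_atom L) : Prop :=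
  match x with
  | CondGeq a b => Pr M (And a b) >= Pr M a * Pr M b
  | GeqCond a b => Pr M (And a b) <= Pr M a * Pr M b
  | ConfirmEq a b => Pr M a = Pr M b
  end.

End Semantics.

Record language (R : realType) (L : Type) := Language {
  formula : Type;
  satisfies : model R L -> formula -> Prop
}.

Definition Lambda (R : realType) (L A : Type)
    (atom_holds : model R L -> A -> Prop) : language R L :=
  @Language R L (bcomb A) (fun M => bholds (atom_holds M)).

Definition L_comp (R : realType) (L : Type) : language R L :=
  Lambda (geq_holds (@uncond_value R L)).

Definition L_add (R : realType) (L : Type) : language R L :=
  Lambda (geq_holds (@add_value R L)).

Definition L_cond (R : realType) (L : Type) : language R L :=
  Lambda (@cond_holds R L).

Definition L_quad (R : realType) (L : Type) : language R L :=
  Lambda (geq_holds (@quad_value R L)).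

Definition L_poly (R : realType) (L : Type) : language R L :=
  Lambda (geq_holds (@poly_value R L)).

Definition L_ind (R : realType) (L : Type) : language R L :=
  Lambda (@ind_holds R L).

Definition L_confirm (R : realType) (L : Type) : language R L :=
  Lambda (@confirm_holds R L).

Section Expressivity.
Variables (R : realType) (L : Type).
Implicit Types K : language R L.

(* Models form a class too large for [set]: Mod is a plain predicate, and
   equality of such classes is extensional. *)
Definition Mod K (phi : formula K) : model R L -> Prop :=
  fun M => satisfies M phi.

Definition at_least_as_expressive K2 K1 : Prop :=
  forall phi : formula K1, exists psi : formula K2,
    forall M : model R L, Mod phi M <-> Mod psi M.

Definition strictly_less_expressive K1 K2 : Prop :=
  at_least_as_expressive K2 K1 /\ ~ at_least_as_expressive K1 K2.

Definition incomparable_expressivity K1 K2 : Prop :=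
  ~ at_least_as_expressive K1 K2 /\ ~ at_least_as_expressive K2 K1.

End Expressivity.

(* Main.v *)
From HB Require Import structures.
Require Import Defs.
From mathcomp Require Import all_boot all_order all_algebra.
From mathcomp Require Import all_classical all_reals all_analysis.
From mathcomp Require Import ring lra.

(** The inclusions translate atoms: a comparison of probabilities is one of
probabilities conditioned on a tautology, a conditional comparison is by
definition one of products, and independence is the conjunction of the two
opposite confirmations.

By transitivity all non-inclusions reduce to five.  Four of them are witnessed
by a pair of models that no atom of one language tells apart, although a
formula of the other does; all the probabilities involved are integers over a
common denominator, so that indistinguishability is a finite computation.
- [quad_not_ge_add].  With two outcomes of probabilities p < q = 1 - p, the
  products are ordered 0 < p^2 < pq < p < q^2 < q < 1 as long as
  p < (3 - sqrt 5) / 2, about 0.38, but 2p >= q holds only from p = 1/3 on.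
- [cond_not_ge_quad].  With two outcomes the conditional probabilities are
  0 < p < q < 1 whenever 0 < p < 1/2, but whether p >= q^2 depends on the
  side of (3 - sqrt 5) / 2 on which p lies.
- [confirm_not_ge_comp].  With two outcomes of unequal probabilities, events
  are correlated in a way that does not tell which outcome is the likelier.
- [ind_not_ge_confirm].  If no two different events of a four-outcome model are
  equiprobable and no two nontrivial events are independent, then
  permuting the probabilities changes the truth of no atom for equality or
  independence, but may turn a positive correlation into a negative one.

For [add_not_ge_ind] no single pair will do: comparing integer combinations of
reals determines the reals up to a factor.  Instead the models depend on the
additive formula.  Two independent letters of equal probability s give a curve
of models, s ranging over (0, 1].  By pigeonhole, two points of the curve agree
on all atoms of a given additive formula; these atoms and their negations being
linear inequalities, the midpoint agrees too.  But the midpoint of two points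
of the curve is off the curve, and there the letters are dependent. *)

Set Implicit Arguments.
Unset Strict Implicit.
Unset Printing Implicit Defensive.

Import Order.TTheory GRing.Theory Num.Theory.

Local Open Scope classical_set_scope.
Local Open Scope card_scope.

(** * Comparing languages *)

Section Comparison.
Variables (R : realType) (L : Type).
Implicit Types K : language R L.

Lemma at_least_as_expressive_trans K1 K2 K3 :
  at_least_as_expressive K3 K2 -> at_least_as_expressive K2 K1 ->
  at_least_as_expressive K3 K1.
Proof.
move=> K32 K21 phi; have [psi phiE] := K21 phi; have [chi psiE] := K32 psi.
by exists chi => M; rewrite phiE.
Qed.

Lemma at_least_as_expressive_refl K : at_least_as_expressive K K.
Proof. by move=> phi; exists phi. Qed.

Lemma not_expressive_mono K1 K2 K1' K2' :
  ~ at_least_as_expressive K1 K2 ->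
  at_least_as_expressive K1 K1' -> at_least_as_expressive K2' K2 ->
  ~ at_least_as_expressive K1' K2'.
Proof.
move=> K12 K11' K2'2 K12'; apply/K12/(at_least_as_expressive_trans K11').
exact: at_least_as_expressive_trans K12' K2'2.
Qed.

Lemma bholds_ext (A : Type) (g h : A -> Prop) (phi : bcomb A) :
  (forall x, g x <-> h x) -> bholds g phi <-> bholds h phi.
Proof. by move=> gh; elim: phi => //= [phi IH|phi IH psi IH']; tauto. Qed.

(** An inclusion between languages of Boolean combinations only has to be
checked on atoms. *)
Lemma Lambda_translation (A B : Type) (g : model R L -> A -> Prop)
    (h : model R L -> B -> Prop) :
  (forall x : A, exists psi, forall M, g M x <-> bholds (h M) psi) ->
  at_least_as_expressive (Lambda h) (Lambda g).
Proof.
move=> gh; rewrite /at_least_as_expressive /Mod /=.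
elim=> [//|phi [phi' IH]|phi [phi' IH] psi [psi' IH']].
  by exists (Neg phi') => M /=; rewrite IH.
by exists (And phi' psi') => M /=; rewrite IH IH'.
Qed.

Lemma Lambda_indistinguishable (A B : Type) (g : model R L -> A -> Prop)
    (h : model R L -> B -> Prop) (M N : model R L) (phi : bcomb A) :
  (forall x, h M x <-> h N x) -> bholds (g M) phi -> ~ bholds (g N) phi ->
  ~ at_least_as_expressive (Lambda h) (Lambda g).
Proof.
move=> hMN gM gN /(_ phi)[psi phiE]; apply: gN.
by apply/phiE/(bholds_ext psi hMN)/phiE.
Qed.

End Comparison.

(** * Inclusions *)

Section Inclusions.
Local Open Scope ring_scope.
Variables (R : realType) (L : Type) (x0 : L).

Let top : bcomb L := Neg (And (Atom x0) (Neg (Atom x0))).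

Lemma valuation_top (M : model R L) : valuation M top = setT.
Proof. by rewrite valuation_Neg valuation_And valuation_Neg setICr setC0. Qed.

Lemma Pr_top (M : model R L) : Pr M top = 1.
Proof. by rewrite /Pr valuation_top probability_setT. Qed.

Lemma Pr_And_top (M : model R L) a : Pr M (And a top) = Pr M a.
Proof. by rewrite /Pr valuation_And valuation_top setIT. Qed.

Lemma add_ge_comp : at_least_as_expressive (L_add R L) (L_comp R L).
Proof.
apply: Lambda_translation => -[[a] [b]].
by exists (Atom (Geq (AddPr a) (AddPr b))).
Qed.

Lemma poly_ge_add : at_least_as_expressive (L_poly R L) (L_add R L).
Proof.
pose fix poly (t : add_term L) := match t with
  | AddPr a => PolyPr a | AddPlus s t => PolyPlus (poly s) (poly t) end.
have polyE M t : poly_value M (poly t) = add_value M t.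
  by elim: t => //= s -> t ->.
apply: Lambda_translation => -[s t]; exists (Atom (Geq (poly s) (poly t))) => M.
by rewrite /= !polyE.
Qed.

Lemma cond_ge_comp : at_least_as_expressive (L_cond R L) (L_comp R L).
Proof.
apply: Lambda_translation => -[[a] [b]].
exists (Atom (Geq (CondPr a top) (CondPr b top))) => M /=.
by rewrite !Pr_And_top Pr_top !mulr1.
Qed.

Lemma quad_ge_cond : at_least_as_expressive (L_quad R L) (L_cond R L).
Proof.
apply: Lambda_translation => -[[a b] [c d]].
by exists (Atom (Geq (QuadMul (And a b) d) (QuadMul (And c d) b))).
Qed.

Lemma poly_ge_quad : at_least_as_expressive (L_poly R L) (L_quad R L).
Proof.
apply: Lambda_translation => -[[a b] [c d]].
by exists (Atom (Geq (PolyMul (PolyPr a) (PolyPr b))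
                     (PolyMul (PolyPr c) (PolyPr d)))).
Qed.

Lemma confirm_ge_ind : at_least_as_expressive (L_confirm R L) (L_ind R L).
Proof.
apply: Lambda_translation => -[[a] [b]|[a] [b]].
  by exists (Atom (ConfirmEq a b)).
exists (And (Atom (CondGeq a b)) (Atom (GeqCond a b))) => M /=.
by split=> [->//|[ge le]]; apply: le_anti; rewrite ge le.
Qed.

Lemma cond_ge_confirm : at_least_as_expressive (L_cond R L) (L_confirm R L).
Proof.
apply: Lambda_translation => -[a b|a b|a b].
- exists (Atom (Geq (CondPr a b) (CondPr a top))) => M /=.
  by rewrite Pr_And_top Pr_top mulr1.
- exists (Atom (Geq (CondPr a top) (CondPr a b))) => M /=.
  by rewrite Pr_And_top Pr_top mulr1.
- exists (And (Atom (Geq (CondPr a top) (CondPr b top)))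
              (Atom (Geq (CondPr b top) (CondPr a top)))) => M /=.
  rewrite !Pr_And_top Pr_top !mulr1.
  by split=> [->//|[ge le]]; apply: le_anti; rewrite ge le.
Qed.

End Inclusions.

(** * Finitely supported models *)

Section PointModels.
Local Open Scope ring_scope.
Variables (R : realType) (L : Type) (index : L -> nat).

(** Outcomes are natural numbers read in binary: the letter of index [k] holds
at [i] when the [k]-th binary digit of [i] is 1.  This single valuation serves
all models below, which differ by their probabilities only. *)
Definition true_at (i : nat) (a : bcomb L) : bool :=
  `[< bholds (fun x => odd (i %/ 2 ^ index x)) a >].

Lemma true_at_Atom i x : true_at i (Atom x) = odd (i %/ 2 ^ index x).
Proof. exact: asboolb. Qed.

Lemma true_at_Neg i a : true_at i (Neg a) = ~~ true_at i a.
Proof. exact: asbool_neg. Qed.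

Lemma true_at_And i a b : true_at i (And a b) = true_at i a && true_at i b.
Proof. exact: asbool_and. Qed.

(** The separations only see a model through the probabilities of events, so
this is all that is recorded of it. *)
Lemma point_model (n : nat) (w : nat -> R) :
  (forall i, 0 <= w i) -> \sum_(i < n) w i = 1 ->
  exists M : model R L, forall a, Pr M a = \sum_(i < n | true_at i a) w i.
Proof.
move=> w_ge0 sumw.
pose mu : {measure set nat -> \bar R} :=
  msum (fun i => mscale (NngNum (w_ge0 i)) (dirac i)) n.
have muE A : mu A = (\sum_(i < n) w i * (nat_of_ord i \in A)%:R)%:E.
  rewrite /mu /= /msum -sumEFin; apply: eq_bigr => i _.
  by rewrite /= /mscale /= diracE.
have mu1 : mu setT = 1%E.
  rewrite muE -[X in _ = X%:E]sumw; congr (_%:E); apply: eq_bigr => i _.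
  by rewrite in_setT /= mulr1.
pose P : probability nat R :=
  HB.pack (Measure.sort mu) (Measure_isProbability.Build _ _ _ mu mu1).
pose v (a : bcomb L) : set nat :=
  [set i | bholds (fun x => odd (i %/ 2 ^ index x)) a].
have vN a : v (Neg a) = ~` v a by [].
have vA a b : v (And a b) = v a `&` v b by [].
have vm x : measurable (v (Atom x)) by [].
exists (@Model R L _ _ P v vN vA vm) => a; rewrite /Pr /=.
transitivity (fine (mu (v a))) => //.
rewrite muE /= [RHS]big_mkcond; apply: eq_bigr => i _.
have -> : (nat_of_ord i \in v a) = true_at i a by [].
by case: true_at; rewrite /= ?mulr1 ?mulr0.
Qed.

(** Written as a sum over an explicit list so that it computes, for a concrete
[ws], to an expression in the truth values of [a] at finitely many outcomes. *)
Definition mass (ws : seq nat) (a : bcomb L) : nat :=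
  sumn [seq (true_at i a * nth 0 ws i)%N | i <- iota 0 (size ws)].

Definition has_weights (M : model R L) (ws : seq nat) : Prop :=
  (0 < sumn ws)%N /\ forall a, Pr M a = (mass ws a)%:R / (sumn ws)%:R.

Lemma weighted_model (ws : seq nat) :
  (0 < sumn ws)%N -> exists M : model R L, has_weights M ws.
Proof.
move=> ws_gt0; have wsR : (sumn ws)%:R != 0 :> R by rewrite pnatr_eq0 -lt0n.
have [||M PrE] := @point_model (size ws)
    (fun i => (nth 0%N ws i)%:R / (sumn ws)%:R).
- by move=> i; rewrite divr_ge0.
- rewrite -mulr_suml -natr_sum (_ : (\sum_(i < _) _)%N = sumn ws) ?divff//.
  by rewrite sumnE (big_nth 0%N) big_mkord.
exists M; split=> // a; rewrite PrE -mulr_suml -natr_sum; congr (_%:R / _).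
rewrite /mass sumnE big_map -[in iota _ _](subn0 (size ws)).
rewrite -/(index_iota 0 (size ws)) big_mkord big_mkcond; apply: eq_bigr => i _.
by case: true_at; rewrite ?mul1n.
Qed.

Section Weights.
Variables (M : model R L) (ws : seq nat) (Mws : has_weights M ws).

Let ws_gt0 : 0 < (sumn ws)%:R^-1 :> R.
Proof. by rewrite invr_gt0 ltr0n; case: Mws. Qed.

Lemma weights_le a b : (Pr M a <= Pr M b) = (mass ws a <= mass ws b)%N.
Proof. by case: Mws => _ E; rewrite !E ler_pM2r// ler_nat. Qed.

Lemma weights_eq a b : (Pr M a == Pr M b) = (mass ws a == mass ws b).
Proof. by rewrite eq_le !weights_le eqn_leq. Qed.

Lemma weights_mul_le a b c d : (Pr M a * Pr M b <= Pr M c * Pr M d) =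
  (mass ws a * mass ws b <= mass ws c * mass ws d)%N.
Proof.
case: Mws => _ E; rewrite !E (mulrACA (mass ws a)%:R) (mulrACA (mass ws c)%:R).
by rewrite ler_pM2r ?mulr_gt0// -!natrM ler_nat.
Qed.

(** Puts a probability over the squared denominator, on a par with products of
two probabilities. *)
Lemma weights_mul_total a : Pr M a =
  (mass ws a * sumn ws)%:R * ((sumn ws)%:R^-1 * (sumn ws)%:R^-1).
Proof.
case: Mws => W E; rewrite E natrM mulrA mulfK// pnatr_eq0 -lt0n//.
Qed.

Lemma weights_le_mul a b c : (Pr M c <= Pr M a * Pr M b) =
  (mass ws c * sumn ws <= mass ws a * mass ws b)%N.
Proof.
case: Mws => _ E; rewrite weights_mul_total !E mulrACA.
by rewrite ler_pM2r ?mulr_gt0// -natrM ler_nat.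
Qed.

Lemma weights_mul_le1 a b c : (Pr M a * Pr M b <= Pr M c) =
  (mass ws a * mass ws b <= mass ws c * sumn ws)%N.
Proof.
case: Mws => _ E; rewrite [Pr M c]weights_mul_total !E mulrACA.
by rewrite ler_pM2r ?mulr_gt0// -natrM ler_nat.
Qed.

End Weights.

End PointModels.

(** * A pigeonhole principle for Boolean combinations *)

(** Among infinitely many valuations [h i] of the atoms, infinitely many agree
on each of the finitely many atoms of [psi].  So a valuation [g i j] bound to
share whatever [h i] and [h j] agree on gives [psi] the same value as they do,
for suitable [i] and [j] that depend on [psi].  Running the induction on the
conclusion itself avoids listing the atoms of [psi]. *)
Lemma infinite_homogeneous (I T : Type) (h : I -> T -> Prop)
    (g : I -> I -> T -> Prop) :
  (forall i j x, (h i x <-> h j x) -> (g i j x <-> h i x)) ->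
  forall (psi : bcomb T) (S : set I), infinite_set S ->
  exists S' : set I, [/\ infinite_set S', S' `<=` S &
    forall i j, S' i -> S' j -> bholds (g i j) psi <-> bholds (h i) psi].
Proof.
move=> gh; elim=> [x|psi IH|psi IH chi IH'] S Sinf.
- have [fin|inf] := pselect (finite_set (S `&` [set i | h i x])).
    exists (S `\` (S `&` [set i | h i x])); split.
    + exact: infinite_setD.
    + exact: subDsetl.
    + by move=> i j [Si nhi] [Sj nhj]; apply: gh; split=> hx;
        [case: nhi | case: nhj].
  exists (S `&` [set i | h i x]); split=> //.
  by move=> i j [_ hi] [_ hj]; apply: gh.
- have [S' [S'inf S'S S'h]] := IH S Sinf.
  by exists S'; split=> // i j Si Sj /=; have := S'h i j Si Sj; tauto.
- have [S' [S'inf S'S S'h]] := IH S Sinf.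
  have [S'' [S''inf S''S' S''h]] := IH' S' S'inf.
  exists S''; split=> //; first exact: subset_trans S'S.
  move=> i j Si Sj /=; have := S''h i j Si Sj.
  have := S'h i j (S''S' _ Si) (S''S' _ Sj); tauto.
Qed.

Lemma infinite_set_pair (I : Type) (S : set I) :
  infinite_set S -> exists i j, [/\ S i, S j & i <> j].
Proof.
move=> Sinf; have [i Si] := infinite_setN0 Sinf.
have [j [Sj ji]] := infinite_setN0 (infinite_setD Sinf (finite_set1 i)).
by exists i, j; split=> // ij; apply: ji.
Qed.

(** * Separations *)

Section Separations.
Local Open Scope ring_scope.
Variables (R : realType) (L : Type) (index : L -> nat) (x0 x1 : L).
Hypotheses (index0 : index x0 = 0%N) (index1 : index x1 = 1%N).

Let A : bcomb L := Atom x0.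
Let B : bcomb L := Atom x1.

Let massE := (true_at_Atom, true_at_Neg, true_at_And, index0, index1).

(** The smaller probability p is 7/20 in the first model and 1/5 in the second:
on either side of 1/3, and both below 0.38. *)
Lemma quad_not_ge_add : ~ at_least_as_expressive (L_quad R L) (L_add R L).
Proof.
have [M MW] := @weighted_model R L index [:: 13; 7] isT.
have [N NW] := @weighted_model R L index [:: 4; 1] isT.
apply: (@Lambda_indistinguishable _ _ _ _ _ _ M N
          (Atom (Geq (AddPlus (AddPr A) (AddPr A)) (AddPr (Neg A))))).
- move=> [[a b] [c d]] /=.
  by rewrite (weights_mul_le MW) (weights_mul_le NW) /mass /=; do 8! case: true_at.
- case: MW => _ E; rewrite /= !E -mulrDl ler_pM2r ?invr_gt0 ?ltr0n//.
  by rewrite -natrD ler_nat /mass /= !massE.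
- case: NW => _ E; rewrite /= !E -mulrDl ler_pM2r ?invr_gt0 ?ltr0n//.
  by rewrite -natrD ler_nat /mass /= !massE.
Qed.

(** Here p is 2/5 and 7/20, on either side of 0.38, and the separating formula
is p * 1 >= q * q. *)
Lemma cond_not_ge_quad : ~ at_least_as_expressive (L_cond R L) (L_quad R L).
Proof.
have [M MW] := @weighted_model R L index [:: 3; 2] isT.
have [N NW] := @weighted_model R L index [:: 13; 7] isT.
apply: (@Lambda_indistinguishable _ _ _ _ _ _ M N
          (Atom (Geq (QuadMul A (Neg (And A (Neg A))))
                     (QuadMul (Neg A) (Neg A))))).
- move=> [[a b] [c d]].
  rewrite /= (weights_mul_le MW) (weights_mul_le NW) /mass /=.
  by rewrite !true_at_And; do 8! case: true_at.
- by rewrite /= (weights_mul_le MW) /mass /= !massE.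
- by rewrite /= (weights_mul_le NW) /mass /= !massE.
Qed.

(** Exchanging the two outcomes preserves the confirmations, since two events
that are neither empty nor full are either equal, hence positively correlated,
or complementary, hence negatively correlated.  It also preserves the
equalities, which hold in neither model between different events. *)
Lemma confirm_not_ge_comp :
  ~ at_least_as_expressive (L_confirm R L) (L_comp R L).
Proof.
have [M MW] := @weighted_model R L index [:: 1; 2] isT.
have [N NW] := @weighted_model R L index [:: 2; 1] isT.
apply: (@Lambda_indistinguishable _ _ _ _ _ _ M N
          (Atom (Geq (UncondPr A) (UncondPr (Neg A))))).
- move=> [a b|a b|a b] /=.
  + rewrite (weights_mul_le1 MW) (weights_mul_le1 NW) /mass /= !true_at_And.
    by do 4! case: true_at.
  + rewrite (weights_le_mul MW) (weights_le_mul NW) /mass /= !true_at_And.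
    by do 4! case: true_at.
  + rewrite (rwP eqP) (weights_eq MW).
    rewrite [X in _ <-> X](rwP eqP) (weights_eq NW) /mass /=.
    by do 4! case: true_at.
- by rewrite /= (weights_le MW) /mass /= !massE.
- by rewrite /= (weights_le NW) /mass /= !massE.
Qed.

(** The weights 1, 2, 4, 10 have distinct subset sums, so that distinct events
have distinct probabilities.  Their total 17 is prime, so that independence,
which says that the product of two masses is 17 times a third one, forces one
of the masses to be 0 or 17.  The weights are listed in the order neither,
only [A], only [B], both: the correlation of [A] and [B] has the sign of
10 * 1 - 2 * 4 in the first model and of 4 * 1 - 10 * 2 in the second. *)
Lemma ind_not_ge_confirm :
  ~ at_least_as_expressive (L_ind R L) (L_confirm R L).
Proof.
have [M MW] := @weighted_model R L index [:: 1; 2; 4; 10] isT.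
have [N NW] := @weighted_model R L index [:: 1; 10; 2; 4] isT.
apply: (@Lambda_indistinguishable _ _ _ _ _ _ M N (Atom (CondGeq A B))).
- move=> [[a] [b]|[a] [b]] /=.
  + rewrite (rwP eqP) (weights_eq MW).
    rewrite [X in _ <-> X](rwP eqP) (weights_eq NW) /mass /=.
    by do 8! case: true_at.
  + rewrite (rwP eqP) eq_le (weights_le_mul MW) (weights_mul_le1 MW).
    rewrite [X in _ <-> X](rwP eqP) eq_le.
    rewrite (weights_le_mul NW) (weights_mul_le1 NW).
    by rewrite /mass /= !true_at_And; do 8! case: true_at.
- by rewrite /= (weights_mul_le1 MW) /mass /= !massE.
- by rewrite /= (weights_mul_le1 NW) /mass /= !massE.
Qed.

(** The weights of two independent letters of probability [s] each. *)
Definition coin_weight (s : R) (i : nat) : R :=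
  (if odd i then s else 1 - s) * (if odd (i %/ 2) then s else 1 - s).

Lemma coin_weight_ge0 s i : 0 <= s <= 1 -> 0 <= coin_weight s i.
Proof.
by move=> /andP[s0 s1]; apply: mulr_ge0; case: ifP => // _; rewrite subr_ge0.
Qed.

Lemma sum_coin_weight s : \sum_(i < 4) coin_weight s i = 1.
Proof. by rewrite !big_ord_recl big_ord0 /coin_weight /=; ring. Qed.

Lemma coin_model s : 0 <= s <= 1 -> exists M : model R L,
  forall a, Pr M a = \sum_(i < 4 | true_at index i a) coin_weight s i.
Proof.
move=> s01; apply: point_model (sum_coin_weight s) => i.
exact: coin_weight_ge0.
Qed.

Lemma midpoint_coin_model s t : 0 <= s <= 1 -> 0 <= t <= 1 ->
  exists M : model R L, forall a,
  Pr M a = (\sum_(i < 4 | true_at index i a) coin_weight s i +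
            \sum_(i < 4 | true_at index i a) coin_weight t i) / 2.
Proof.
move=> s01 t01.
have [||M ME] := @point_model R L index 4
    (fun i => (coin_weight s i + coin_weight t i) / 2).
- by move=> i; rewrite divr_ge0// addr_ge0// coin_weight_ge0.
- by rewrite -mulr_suml big_split /= !sum_coin_weight; lra.
by exists M => a; rewrite ME -mulr_suml big_split.
Qed.

(** The additive formula comes first, the models second: the pigeonhole
principle is applied to a sequence on the curve of independent models, and the
resulting pair is compared with its midpoint. *)
Lemma add_not_ge_ind : ~ at_least_as_expressive (L_add R L) (L_ind R L).
Proof.
pose s (k : nat) : R := k.+1%:R^-1.
have s01 k : 0 <= s k <= 1 by rewrite invr_ge0 ler0n invf_le1 ?ltr0n// ler1n.
have [M ME] := choice (fun k => coin_model (s01 k)).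
have [N NE] := choice (fun kl : nat * nat =>
  midpoint_coin_model (s01 kl.1) (s01 kl.2)).
have valueN k l t :
    add_value (N (k, l)) t = (add_value (M k) t + add_value (M l) t) / 2.
  by elim: t => [a|t1 IH1 t2 IH2] /=; [rewrite NE !ME|rewrite IH1 IH2; lra].
move=> /(_ (Atom (IndIndep (UncondPr A) (UncondPr B))))[psi psiE].
have [k l x|S [Sinf _ Sh]] := @infinite_homogeneous _ _
  (fun k => geq_holds (@add_value R L) (M k))
  (fun k l => geq_holds (@add_value R L) (N (k, l))) _ psi setT infinite_nat.
  (* Both an atom and its negation are convex conditions on a model. *)
  by case: x => t u /=; rewrite !valueN; lra.
have [k [l [Sk Sl kl]]] := infinite_set_pair Sinf.
have coinE t (a := s t) :
  [/\ \sum_(i < 4 | true_at index i A) coin_weight a i = a,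
      \sum_(i < 4 | true_at index i B) coin_weight a i = a &
      \sum_(i < 4 | true_at index i (And A B)) coin_weight a i = a ^+ 2].
  split; rewrite big_mkcond !big_ord_recl big_ord0 !massE /coin_weight /=; ring.
have [kA kB kAB] := coinE k; have [lA lB lAB] := coinE l.
have /psiE/(Sh k l Sk Sl)/psiE : Mod (K := L_ind R L)
    (Atom (IndIndep (UncondPr A) (UncondPr B))) (M k).
  by rewrite /Mod /= !ME kA kB kAB.
rewrite /Mod /= !NE /= kA kB kAB lA lB lAB => indep.
(* Independence at the midpoint is equality in the convexity inequality
     ((s + t) / 2)^2 <= (s^2 + t^2) / 2. *)
have : (s k - s l) ^+ 2 = 0 by lra.
move=> /eqP; rewrite sqrf_eq0 subr_eq0 => /eqP/invr_inj/eqP.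
by rewrite eqr_nat eqSS => /eqP.
Qed.

End Separations.

Theorem theorem1 (R : realType) (L : Type) (hL : [set: L] #= [set: nat]) :
  (* (i) *)
  (strictly_less_expressive (L_comp R L) (L_add R L) /\
   strictly_less_expressive (L_add R L) (L_poly R L)) /\
  (* (ii) *)
  ((strictly_less_expressive (L_comp R L) (L_cond R L) /\
    strictly_less_expressive (L_cond R L) (L_quad R L) /\
    strictly_less_expressive (L_quad R L) (L_poly R L)) /\
   (strictly_less_expressive (L_ind R L) (L_confirm R L) /\
    strictly_less_expressive (L_confirm R L) (L_cond R L))) /\
  (* (iii) *)
  (incomparable_expressivity (L_ind R L) (L_comp R L) /\
   incomparable_expressivity (L_ind R L) (L_add R L) /\
   incomparable_expressivity (L_confirm R L) (L_comp R L) /\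
   incomparable_expressivity (L_confirm R L) (L_add R L) /\
   incomparable_expressivity (L_add R L) (L_cond R L) /\
   incomparable_expressivity (L_add R L) (L_quad R L)).
Proof.
have [index [_ _ surj]] := card_set_bijP hL.
(* Only the letters of index 0 and 1 occur in the separating formulas. *)
have [x0 _ index0] := surj 0%N I; have [x1 _ index1] := surj 1%N I.
have add_comp := @add_ge_comp R L.
have poly_add := @poly_ge_add R L.
have cond_comp := @cond_ge_comp R L x0.
have quad_cond := @quad_ge_cond R L.
have poly_quad := @poly_ge_quad R L.
have confirm_ind := @confirm_ge_ind R L.
have cond_confirm := @cond_ge_confirm R L x0.
have refl := @at_least_as_expressive_refl R L.
have trans := @at_least_as_expressive_trans R L.
have quad_comp := trans _ _ _ quad_cond cond_comp.
have quad_confirm := trans _ _ _ quad_cond cond_confirm.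
have cond_ind := trans _ _ _ cond_confirm confirm_ind.
have quad_ind := trans _ _ _ quad_cond cond_ind.
have poly_ind := trans _ _ _ poly_quad quad_ind.
(* The separations are weakened to languages below the left one and above the
   right one. *)
have quad_add K K' : at_least_as_expressive (L_quad R L) K ->
    at_least_as_expressive K' (L_add R L) -> ~ at_least_as_expressive K K'.
  exact: not_expressive_mono (@quad_not_ge_add R L index x0 index0).
have confirm_comp K K' : at_least_as_expressive (L_confirm R L) K ->
    at_least_as_expressive K' (L_comp R L) -> ~ at_least_as_expressive K K'.
  exact: not_expressive_mono (@confirm_not_ge_comp R L index x0 index0).
have add_ind K K' : at_least_as_expressive (L_add R L) K ->
    at_least_as_expressive K' (L_ind R L) -> ~ at_least_as_expressive K K'.
  exact: not_expressive_mono (@add_not_ge_ind R L index x0 x1 index0 index1).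
have cond_quad := @cond_not_ge_quad R L index x0 index0.
have ind_confirm := @ind_not_ge_confirm R L index x0 x1 index0 index1.
split; [split | split; [split; [split; [|split] | split] |]];
  last (split; [|split; [|split; [|split; [|split]]]]).
- by split=> //; exact: quad_add.
- by split=> //; exact: add_ind.
- by split=> //; exact: add_ind.
- by split.
- by split=> //; exact: quad_add.
- by split.
- by split=> //; exact: confirm_comp.
- by split; [exact: confirm_comp | exact: add_ind].
- by split; [exact: quad_add | exact: add_ind].
- by split; [exact: confirm_comp | exact: add_ind].
- by split; [exact: quad_add | exact: add_ind].
- by split; [exact: add_ind | exact: quad_add].
- by split; [exact: add_ind | exact: quad_add].
Qed.
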